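(* Let $N\ge 2$, $U,V$ be random hermitian $N\times N$ matrices and $\mathbf K\ge 1$ a random variable as described in the context. Evaluate $UV+VU$ and $\mathbf K$ at a sample point of the event $[\|U\|\vee\|V\|\leq4]$, and still write $UV+VU$ and $\mathbf K$ for these evaluations. Let $\lambda$ be an eigenvalue of $UV+VU$ and let $v\in\mathbb C^N$ be a corresponding unit-length (right) eigenvector. Assume that $|\lambda|\leq8$. Let $\rho=4c_*^2\mathbf K^2/N$ and assume that $\rho<1$. Let $\sigma\in[\rho,\rho^{1/3}]$ be defined by the equation $\rho=h(z)^2\,\Im z\,\big|_{z=\lambda+\mathrm i\sigma}$. Then $$\max_{1\le i\le N}|v(i)|\leq\sqrt{2\sigma}.$$
   Context: Notation. $x\vee y=\max(x,y)$, $x\wedge y=\min(x,y)$, $x_\bullet=x\vee 1$; $\mathfrak h=\{z\in\mathbb C:\Im z>0\}$. $\mathrm{Mat}_N$ is the space of $N\times N$ complex matrices, $I_N$ the identity, $\|A\|$ the largest singular value of $A$. For a complex random variable $Z$, $\|Z\|_{L^p}=(\mathbf E|Z|^p)^{1/p}$. For a linear map $T:\mathrm{Mat}_3\to\mathrm{Mat}_3$, $\|T\|$ is the operator norm with respect to the largest-singular-value norm on $\mathrm{Mat}_3$. Functions of $z\in\mathfrak h$. Let $\mathbf u,\mathbf v$ be freely independent (standard, variance one) semicircular noncommutative random variables, $\mu$ the law of $\mathbf u\mathbf v+\mathbf v\mathbf u$, and $m=m(z)=\int\frac{\mu(dt)}{t-z}$. (Taken for granted by a known result of Nica and Speicher: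 $zm^3-m^2-zm-1=0$, and $\mu$ has support $[-\zeta,\zeta]$.) Let $\zeta=\sqrt{\frac{11+5\sqrt5}{2}}$ and $h=h(z)=|z+\zeta|\wedge|z-\zeta|\wedge1$. The constant $c_*$. Let $\{e_{ij}\}$ be the standard basis of $\mathrm{Mat}_3$ and $\Phi(A)=(e_{12}+e_{21})A(e_{12}+e_{21})+(e_{13}+e_{31})A(e_{13}+e_{31})$. For $z\in\mathfrak h$ let $M=\mathrm{diag}\big(m,-\frac1{m-1},-\frac1{m+1}\big)$. The linear map $x\mapsto M^{-1}x-\Phi(x)M$ of $\mathrm{Mat}_3$ to itself is invertible; let $\kappa$ denote its inverse. Then $c_*\geq1$ denotes a fixed absolute constant such that $\frac{1}{8\|\kappa\|_\bullet\|\Phi\|_\bullet}\geq\frac{\sqrt{h(z)}}{c_*}$ for all $z\in\mathfrak h$ (the paper shows such a constant exists). Setting. $\alpha_0>0$, $\alpha_1\ge1$ are constants, $N\ge2$ is an integer, $U,V\in\mathrm{Mat}_N$ are random hermitian matrices such that: $\sup_{p\in[2,\infty)}p^{-\alpha_0}\big(\max_{i,j}\|U(i,j)\|_{L^p}\vee\max_{i,j}\|V(i,j)\|_{L^p}\big)\leq\sqrt{\alpha_1/N}$; the family $\{U(i,j),V(i,j)\}_{1\le i\le j\le N}$ is independent; all entries have mean zero; $\|U(i,j)\|_{L^2}=\|V(i,j)\|_{L^2}=1/\sqrt N$ for $i\neq j$. The random variable $\mathbf K\geq1$ has the following two properties (the paper's main theorem asserts that such $\mathbf K$ exists). (I) On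 the event $[\|U\|\vee\|V\|\leq4]$ one has $\max_i|(UV+VU-zI_N)^{-1}(i,i)-m(z)|\leq\frac{\mathbf K}{\sqrt{Nh(z)\Im z}}$ for all $z\in\mathfrak h$ such that $|\Re z|\vee\Im z\leq8$ and $\frac{4c_*^2\mathbf K^2}{N}\leq h(z)^2\Im z$. (II) For every $t>0$, $\Pr(\mathbf K>t^{2\alpha_0+1})\leq\beta_0N^{\beta_1}\exp(-\beta_2t)$, where $\beta_0,\beta_2>0$ depend only on $\alpha_0,\alpha_1$ and $\beta_1>0$ is absolute. *)

(* Defs.v *)
From HB Require Import structures.
From mathcomp Require Export all_boot all_order all_algebra.
From mathcomp Require Export all_classical all_reals all_analysis.
From mathcomp.real_closed Require Export complex.

Set Implicit Arguments.
Unset Strict Implicit.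
Unset Printing Implicit Defensive.

Import Order.TTheory GRing.Theory Num.Theory.
Import numFieldNormedType.Exports.

Local Open Scope classical_set_scope.
Local Open Scope ring_scope.
Local Open Scope complex_scope.

(* The library norm on [R[i]] is [R[i]]-valued; this is the real modulus. *)
Definition cabs (R : realType) (z : R[i]) : R := complex.Re `|z|.

Definition bullet (R : realType) (x : R) : R := Num.max x 1.

(* The largest singular value. [eigenvalue] is about row vectors, but a square
   matrix has the same left and right eigenvalues. *)
Definition opnorm (R : realType) (n : nat) (A : 'M[R[i]]_n) : R :=
  sup [set s : R | 0 <= s /\
    eigenvalue (map_mx Num.conj A^T *m A) (s ^+ 2)%:C].

Definition map_opnorm (R : realType) (n : nat)
    (T : 'M[R[i]]_n -> 'M[R[i]]_n) : R :=
  sup [set opnorm (T A) | A in [set A | opnorm A <= 1]].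

(* A unital *-algebra over the complex numbers with a state; no topology is
   needed, since laws are determined by moments below. *)
Record ncProbSpace (R : realType) := NcProbSpace {
  nc_alg :> algType R[i];
  nc_star : nc_alg -> nc_alg;
  nc_state : {scalar nc_alg};
  nc_star_antilinear : forall (c : R[i]) (a b : nc_alg),
    nc_star (c *: a + b) = c^* *: nc_star a + nc_star b;
  nc_starM : forall a b : nc_alg, nc_star (a * b) = nc_star b * nc_star a;
  nc_starK : involutive nc_star;
  nc_state1 : nc_state 1 = 1;
  nc_state_ge0 : forall a : nc_alg, 0 <= nc_state (nc_star a * a) }.

(* The unital algebra generated by one element consists of the polynomials in
   that element; [s] is an alternating word of centered elements of the two
   algebras. *)
Definition freely_independent (R : realType) (A : ncProbSpace R) (u v : A) :=
  forall s : seq (bool * {poly R[i]}),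
    let elt (q : bool * {poly R[i]}) : A :=
      horner_alg (if q.1 then u else v) q.2 in
    s <> [::] ->
    sorted (fun q r : bool * {poly R[i]} => q.1 != r.1) s ->
    (forall q, q \in s -> nc_state A (elt q) = 0) ->
    nc_state A (\prod_(q <- s) elt q) = 0.

(* The integral is the k-th moment of the semicircle law of variance 1. *)
Definition standard_semicircular (R : realType) (A : ncProbSpace R) (u : A) :=
  nc_star u = u /\
  forall k : nat, nc_state A (u ^+ k) =
    (\int[lebesgue_measure]_(t in `[(-2 : R), 2]%classic)
       (t ^+ k * (Num.sqrt (4 - t ^+ 2) / (2 * pi))))%:C.

(* A compactly supported measure is determined by its moments. *)
Definition is_law (R : realType) (A : ncProbSpace R) (a : A)
    (mu : probability (measurableTypeR R) R) :=
  (exists C : R, mu `[- C, C]%classic = 1%E) /\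
  forall k : nat, nc_state A (a ^+ k) = (\int[mu]_t (t ^+ k))%:C.

Definition measure_support (R : realType)
    (mu : probability (measurableTypeR R) R) : set R :=
  [set x | forall e : R, 0 < e -> (0 < mu (ball x e))%E].

Definition stieltjes (R : realType)
    (mu : probability (measurableTypeR R) R) (z : R[i]) : R[i] :=
  (\int[mu]_t complex.Re ((t%:C - z)^-1)) +i*
  (\int[mu]_t complex.Im ((t%:C - z)^-1)).

Definition zeta (R : realType) : R :=
  Num.sqrt ((11 + 5 * Num.sqrt 5) / 2).

Definition edge_dist (R : realType) (z : R[i]) : R :=
  Num.min (Num.min (cabs (z + (zeta R)%:C)) (cabs (z - (zeta R)%:C))) 1.

(* Indices start at 0: [e12] is [delta_mx 0 1]. *)
Definition Phi (R : realType) (A : 'M[R[i]]_3) : 'M[R[i]]_3 :=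
  let S2 : 'M[R[i]]_3 := delta_mx 0 1 + delta_mx 1 0 in
  let S3 : 'M[R[i]]_3 := delta_mx 0 2 + delta_mx 2 0 in
  S2 *m A *m S2 + S3 *m A *m S3.

Definition Mdiag (R : realType) (m : R[i]) : 'M[R[i]]_3 :=
  diag_mx (\row_(j < 3) [:: m; - (m - 1)^-1; - (m + 1)^-1]`_j).

Definition stability_map (R : realType) (m : R[i]) (x : 'M[R[i]]_3) :
    'M[R[i]]_3 :=
  invmx (Mdiag m) *m x - Phi x *m Mdiag m.

(* Independence of the subfamily of [X] indexed by [D]. *)
Definition mutually_independent (R : realType) (d d' : measure_display)
    (T : measurableType d) (T' : measurableType d') (P : probability T R)
    (I : finType) (D : {set I}) (X : I -> T -> T') :=
  forall (J : {set I}) (B : I -> set T'), J \subset D ->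
    (forall k, measurable (B k)) ->
    P [set w | forall k, k \in J -> B k (X k w)] =
    (\prod_(k in J) fine (P (X k @^-1` B k)))%:E.

Definition re_im (R : realType) (z : R[i]) :
    (measurableTypeR R * measurableTypeR R)%type :=
  (complex.Re z, complex.Im z).

Definition random_matrix (R : realType) (d : measure_display)
    (T : measurableType d) (N : nat) (U : T -> 'M[R[i]]_N) :=
  forall i j, measurable_fun setT (fun w => re_im (U w i j)).

Definition upper_family (R : realType) (T : Type) (N : nat)
    (U V : T -> 'M[R[i]]_N) (k : bool * 'I_N * 'I_N) (w : T) :=
  re_im ((if k.1.1 then U w else V w) k.1.2 k.2).

Definition upper_indices (N : nat) : {set bool * 'I_N * 'I_N} :=
  [set k : bool * 'I_N * 'I_N | (k.1.2 <= k.2)%N]%SET.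

Definition centered (R : realType) (d : measure_display) (T : measurableType d)
    (P : probability T R) (Z : T -> R[i]) :=
  expectation P (fun w => complex.Re (Z w)) = 0%E /\
  expectation P (fun w => complex.Im (Z w)) = 0%E.

Definition cLnorm (R : realType) (d : measure_display) (T : measurableType d)
    (P : probability T R) (p : R) (Z : T -> R[i]) : \bar R :=
  Lnorm P p%:E (fun w => (cabs (Z w))%:E).

Definition max_cLnorm (R : realType) (d : measure_display)
    (T : measurableType d) (P : probability T R) (p : R) (N : nat)
    (U : T -> 'M[R[i]]_N) : \bar R :=
  (\big[maxe/0]_(i < N) \big[maxe/0]_(j < N)
     cLnorm P p (fun w => U w i j))%E.

(* Main.v *)
Require Import Defs.
From mathcomp Require Import ring lra.

(** Write X for the hermitian matrix UV + VU and G for its resolvent at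
    z = lambda + i sigma. The imaginary part of a diagonal entry of G dominates
    the corresponding entry of every eigenvector whose eigenvalue lies under z:
    spectrally, Im G(i,i) is the sum over an orthonormal eigenbasis (v_k) of
    sigma |v_k(i)|^2 / ((lambda_k - lambda)^2 + sigma^2), and the term of
    lambda itself is |x(i)|^2 / sigma. So |x(i)|^2 <= sigma Im G(i,i), and it
    is enough that Im G(i,i) <= 2.

    The inequality is obtained without diagonalising X. The Ward identity
    [resolvent_ward] says that Im G(i,i) is Im z times the squared norm of the
    i-th row g of G, while (X - z) x = (lambda - z) x gives
    x(i) = (lambda - z) g x; Cauchy-Schwarz concludes
    ([eigenvector_entry_le], [unit_eigenvector_entry_le]).

    To bound Im G(i,i), compare it with Im m(z). With h = edge_dist z, the
    equation defining sigma places z on the boundary of the domain where K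
    controls G(i,i) - m(z), and there K^2 / N = h^2 sigma / (4 cstar^2), so that the error
    K / sqrt (N h sigma) is at most sqrt h / (2 cstar) <= 1. On the other hand
    Im m(z) < 1 because m(z) solves the cubic equation with Im z > 0
    ([cubic_root_Im_lt1]). *)

Set Implicit Arguments.
Unset Strict Implicit.
Unset Printing Implicit Defensive.

Import Order.TTheory GRing.Theory Num.Theory.
Import numFieldNormedType.Exports.

Local Open Scope classical_set_scope.
Local Open Scope ring_scope.
Local Open Scope complex_scope.

Local Notation adj A := (map_mx Num.conj A^T).

Lemma adj_mul (C : numClosedFieldType) m p q (A : 'M[C]_(m, p))
    (B : 'M[C]_(p, q)) :
  adj (A *m B) = adj B *m adj A.
Proof. by rewrite trmx_mul map_mxM. Qed.

Lemma adjK (C : numClosedFieldType) m p (A : 'M[C]_(m, p)) : adj (adj A) = A.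
Proof. by apply/matrixP => i j; rewrite !mxE conjCK. Qed.

Lemma hermsymmx_adj (C : numClosedFieldType) n (A : 'M[C]_n) :
  A \is hermsymmx -> adj A = A.
Proof. by move/is_hermitianmxP => {2}->; rewrite expr0 scale1r. Qed.

Lemma hermsymmx_anticommutator (C : numClosedFieldType) n (A B : 'M[C]_n) :
  A \is hermsymmx -> B \is hermsymmx -> A *m B + B *m A \is hermsymmx.
Proof.
move=> /hermsymmx_adj hA /hermsymmx_adj hB; apply/is_hermitianmxP.
by rewrite expr0 scale1r linearD /= map_mxD !adj_mul hA hB addrC.
Qed.

(** If v (A - z) = 0 then moving A across the inner product [v A, v] turns z
    into its conjugate, so z would be real. *)
Lemma unitmx_hermsymmx_shift (C : numClosedFieldType) n (A : 'M[C]_n) (z : C) :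
  A \is hermsymmx -> 'Im z != 0 -> A - z%:M \in unitmx.
Proof.
move=> hA nz; rewrite -row_free_unit -kermx_eq0; apply/negPn/negP => /rowV0Pn[v].
move/sub_kermxP => /eqP; rewrite mulmxBr mul_mx_scalar subr_eq0 => /eqP vA v0.
have: dotmx (v *m A) v = dotmx v (v *m A).
  by rewrite !dotmxE adj_mul hermsymmx_adj // mulmxA.
rewrite vA linearZl_LR linearZr_LR /= => /mulIf.
rewrite (dnorm_eq0 (@dotmx C n)) v0 => /(_ isT) /esym zE.
by case/eqP: nz; apply/Creal_ImP; rewrite CrealE zE.
Qed.

(** The eigenvector here is a column, for which the previous lemma gives the
    reality of the eigenvalue without transposing: were A - l invertible, x
    would vanish. *)
Lemma hermsymmx_eigenvalue_Im0 (C : numClosedFieldType) n (A : 'M[C]_n)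
    (l : C) (x : 'cV[C]_n) :
  A \is hermsymmx -> A *m x = l *: x -> x != 0 -> 'Im l = 0.
Proof.
move=> hA Ax; apply: contraNeq => /(unitmx_hermsymmx_shift hA) Ul.
by rewrite -(mulKmx Ul x) mulmxBl Ax mul_scalar_mx subrr mulmx0.
Qed.

(** Ward identity. It is the diagonal of the resolvent identity
    G - G^* = G ((A - z)^* - (A - z)) G^*, where the middle factor is the scalar
    z - z^* because A is hermitian. *)
Lemma resolvent_ward (C : numClosedFieldType) n (A : 'M[C]_n) (z : C) i
    (G := invmx (A - z%:M)) :
  A \is hermsymmx -> 'Im z != 0 ->
  'Im (G i i) = 'Im z * dotmx (row i G) (row i G).
Proof.
move=> hA nz; have U := unitmx_hermsymmx_shift hA nz.
have adjM : adj (A - z%:M) = A - (Num.conj z)%:M.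
  by rewrite linearB /= map_mxB hermsymmx_adj // tr_scalar_mx map_scalar_mx.
have e1 : G *m adj (A - z%:M) *m adj G = G.
  by rewrite -mulmxA -adj_mul mulVmx // trmx1 map_mx1 mulmx1.
have e2 : G *m (A - z%:M) *m adj G = adj G by rewrite mulVmx // mul1mx.
have GG : G - adj G = (z - Num.conj z) *: (G *m adj G).
  rewrite -[X in X - _]e1 -[X in _ - X]e2 -mulmxBl -mulmxBr adjM opprB addrC addrA addrNK.
  by rewrite -raddfB mul_mx_scalar -scalemxAl.
have Gii : G i i - Num.conj (G i i) =
    (z - Num.conj z) * dotmx (row i G) (row i G).
  have /matrixP/(_ i i) := GG; rewrite dotmxE !mxE => ->; congr (_ * _).
  by apply: eq_bigr => j _; rewrite !mxE.
rewrite !ImE -opprB Gii. ring.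
Qed.

(** Applying G to (A - z) x = (l - z) x gives x(i) = (l - z) g x with g the
    i-th row of G; by Cauchy-Schwarz |x(i)|^2 <= |l - z|^2 |g|^2 |x|^2, and the
    Ward identity trades |g|^2 for Im G(i,i) / Im z. *)
Lemma eigenvector_entry_le (C : numClosedFieldType) n (A : 'M[C]_n) (z l : C)
    (x : 'cV[C]_n) i :
  A \is hermsymmx -> 0 < 'Im z -> A *m x = l *: x ->
  'Im z * `|x i 0| ^+ 2 <=
  `|l - z| ^+ 2 * 'Im (invmx (A - z%:M) i i) * \sum_j `|x j 0| ^+ 2.
Proof.
move=> hA z0 Ax; have nz : 'Im z != 0 by rewrite gt_eqF.
have U := unitmx_hermsymmx_shift hA nz; rewrite resolvent_ward //.
set G := invmx _; set g := row i G.
have -> : \sum_j `|x j 0| ^+ 2 = dotmx (adj x) (adj x).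
  rewrite dotmxE adjK mxE; apply: eq_bigr => j _.
  by rewrite !mxE mulrC normCK.
have -> : x i 0 = (l - z) * dotmx g (adj x).
  rewrite dotmxE adjK -row_mul.
  rewrite -[in LHS](mulKmx U x) mulmxBl Ax mul_scalar_mx -scalerBl -scalemxAr.
  by rewrite !mxE.
have [le_gx _] := CauchySchwarz (@dotmx C n) g (adj x).
rewrite normrM exprMn mulrCA -[X in _ <= X]mulrA ler_wpM2l ?exprn_ge0 //.
by rewrite -[X in _ <= X]mulrA ler_wpM2l ?(ltW z0).
Qed.

Lemma cabsE (R : realType) (z : R[i]) : `|z| = (cabs z)%:C.
Proof. by rewrite RRe_real ?normr_real. Qed.

Lemma Re_inv (R : rcfType) (z : R[i]) :
  complex.Im z^-1 = - complex.Im z / (complex.Re z ^+ 2 + complex.Im z ^+ 2).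
Proof. by case: z => a b; rewrite /= mulNr. Qed.

(** Solved for z, the cubic reads z = 1/(m-1) + 1/(m+1) - 1/m. With b = Im m
    this gives Im z = b (1/|m|^2 - 1/|m-1|^2 - 1/|m+1|^2). If |m| >= 1, the
    parallelogram law |m-1|^2 + |m+1|^2 = 2 |m|^2 + 2 makes the bracket
    nonpositive, so b >= 1 is incompatible with Im z > 0. *)
Lemma cubic_root_Im_lt1 (R : rcfType) (z m : R[i]) :
  0 < complex.Im z -> z * m ^+ 3 - m ^+ 2 - z * m - 1 = 0 -> complex.Im m < 1.
Proof.
move=> z0 cubic; rewrite ltNge; apply/negP => m1.
have m0 : m != 0 by apply/eqP => m0; move: m1; rewrite m0 /= ler10.
have mB : m - 1 != 0.
  by rewrite subr_eq0; apply/eqP => m0'; move: m1; rewrite m0' /= ler10.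
have mD : m + 1 != 0.
  by rewrite addr_eq0; apply/eqP => m0'; move: m1; rewrite m0' /= oppr0 ler10.
have zP : z * (m * ((m - 1) * (m + 1))) = m ^+ 2 + 1.
  by apply/eqP; rewrite -subr_eq0 -[X in _ == X]cubic; apply/eqP; ring.
have zE : z = (m - 1)^-1 + (m + 1)^-1 - m^-1.
  apply: (mulIf (x := m * ((m - 1) * (m + 1)))); first by rewrite !mulf_neq0.
  by rewrite zP; field; rewrite m0 mB mD.
move: z0 m1; rewrite zE !raddfD raddfN /= !Re_inv !raddfD !raddfN /= subr0.
move: (complex.Re m) (complex.Im m) => a b /[swap] b1.
rewrite !oppr0 !addr0.
have [b0 b2] : 0 < b /\ 1 <= b ^+ 2 by split; nra.
set p := (a - 1) ^+ 2 + _; set q := (a + 1) ^+ 2 + _; set r := a ^+ 2 + _.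
have p0 : 0 < p by rewrite /p; nra.
have q0 : 0 < q by rewrite /q; nra.
have r0 : 0 < r by rewrite /r; nra.
have -> : - b / p + - b / q - - b / r =
    - (b * (r * (p + q) - p * q) / (p * q * r)).
  by field; rewrite !gt_eqF.
(* Here p, q, r are |m-1|^2, |m+1|^2, |m|^2, with p + q = 2 (r + 1) and
   p q = (r + 1)^2 - 4 a^2. *)
have -> : r * (p + q) - p * q = (r + 1) * (r - 1) + 4 * a ^+ 2.
  by rewrite /p /q /r; ring.
rewrite oppr_gt0 ltNge; apply/negP; rewrite negbK.
rewrite divr_ge0 ?mulr_ge0 ?(ltW b0) ?(ltW p0) ?(ltW q0) ?(ltW r0) //.
have r1 : 1 <= r by rewrite /r; nra.
nra.
Qed.


Lemma cabs_ge0 (R : realType) (z : R[i]) : 0 <= cabs z.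
Proof. by rewrite -lecR -cabsE normr_ge0. Qed.

Lemma Im_le_cabs (R : realType) (z : R[i]) : complex.Im z <= cabs z.
Proof.
rewrite /cabs normc_def /=; apply: le_trans (ler_norm _) _.
by rewrite -sqrtr_sqr ler_wsqrtr // lerDr sqr_ge0.
Qed.

Lemma edge_dist_ge0 (R : realType) (z : R[i]) : 0 <= edge_dist z.
Proof. by rewrite !le_min !cabs_ge0 ler01. Qed.

Lemma edge_dist_le1 (R : realType) (z : R[i]) : edge_dist z <= 1.
Proof. by rewrite ge_min lexx orbT. Qed.

(** The case z = l + i s, where |l - z| = Im z = s. The point z lies directly
    above l because the eigenvalue l is real. *)
Lemma unit_eigenvector_entry_le (R : realType) n (A : 'M[R[i]]_n) (l : R[i])
    (s : R) (x : 'cV[R[i]]_n) i :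
  A \is hermsymmx -> 0 < s -> A *m x = l *: x ->
  \sum_j cabs (x j 0) ^+ 2 = 1 ->
  complex.Im l = 0 /\
  cabs (x i 0) ^+ 2 <= s * complex.Im (invmx (A - (l + s *i)%:M) i i).
Proof.
move=> hA s0 Ax x1.
have xn0 : x != 0.
  apply/eqP => x0; move: x1; rewrite x0 big1 => [/esym/eqP|j _].
    by rewrite oner_eq0.
  by rewrite mxE /cabs normr0 expr0n.
have l0 : complex.Im l = 0.
  by apply: complexI; rewrite complexIm (hermsymmx_eigenvalue_Im0 hA Ax).
split=> //.
have zE : complex.Im (l + s *i) = s by rewrite raddfD /= l0 add0r.
have z0 : 0 < 'Im (l + s *i) by rewrite -complexIm zE ltcR.
have := eigenvector_entry_le i hA z0 Ax.
have -> : \sum_j `|x j 0| ^+ 2 = 1.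
  under eq_bigr do rewrite cabsE -rmorphXn.
  by rewrite -rmorph_sum x1.
have -> : `|l - (l + s *i)| = s%:C.
  by rewrite opprD addNKr normrN normc_def /= expr0n add0r sqrtr_sqr gtr0_norm.
rewrite mulr1 -!complexIm zE cabsE -!rmorphXn -!rmorphM lecR expr2 -mulrA.
by rewrite ler_pM2l.
Qed.

Theorem corollary1p3 (R : realType)
  (A : ncProbSpace R) (u v : A)
  (hu : standard_semicircular u) (hv : standard_semicircular v)
  (huv : freely_independent u v)
  (mu : probability (measurableTypeR R) R)
  (hmu : is_law (u * v + v * u) mu)
  (m : R[i] -> R[i]) (hm : m = stieltjes mu)
  (* [hcubic] and [hsupp]: theorem of Nica and Speicher, taken for granted *)
  (hcubic : forall z : R[i], 0 < complex.Im z ->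
     z * m z ^+ 3 - m z ^+ 2 - z * m z - 1 = 0)
  (hsupp : measure_support mu = `[- zeta R, zeta R]%classic)
  (kappa : R[i] -> 'M[R[i]]_3 -> 'M[R[i]]_3)
  (hkappa : forall z : R[i], 0 < complex.Im z ->
     cancel (stability_map (m z)) (kappa z) /\
     cancel (kappa z) (stability_map (m z)))
  (cstar : R) (hcstar1 : 1 <= cstar)
  (hcstar : forall z : R[i], 0 < complex.Im z ->
     Num.sqrt (edge_dist z) / cstar <=
     1 / (8 * bullet (map_opnorm (kappa z)) * bullet (map_opnorm (@Phi R))))
  (* beta1 is absolute; beta0 and beta2 depend only on alpha0 and alpha1 *)
  (beta1 : R) (hbeta1 : 0 < beta1)
  (beta0 beta2 : R -> R -> R)
  (hbeta : forall a0 a1 : R, 0 < a0 -> 1 <= a1 ->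
     0 < beta0 a0 a1 /\ 0 < beta2 a0 a1)
  (alpha0 alpha1 : R) (halpha0 : 0 < alpha0) (halpha1 : 1 <= alpha1)
  (N : nat) (hN : (2 <= N)%N)
  (d : measure_display) (T : measurableType d) (P : probability T R)
  (U V : T -> 'M[R[i]]_N)
  (hUmeas : random_matrix U) (hVmeas : random_matrix V)
  (hUherm : forall w, U w \is hermsymmx) (hVherm : forall w, V w \is hermsymmx)
  (hmom : (ereal_sup
     [set (p `^ (- alpha0))%:E * maxe (max_cLnorm P p U) (max_cLnorm P p V)
       | p in `[2%R, +oo[%classic] <= (Num.sqrt (alpha1 / N%:R))%:E)%E)
  (hindep : mutually_independent P (upper_indices N) (upper_family U V))
  (hUmean : forall i j, centered P (fun w => U w i j))
  (hVmean : forall i j, centered P (fun w => V w i j))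
  (hvar : forall i j : 'I_N, i != j ->
     cLnorm P 2 (fun w => U w i j) = (1 / Num.sqrt N%:R)%:E /\
     cLnorm P 2 (fun w => V w i j) = (1 / Num.sqrt N%:R)%:E)
  (K : {RV P >-> R}) (hK1 : forall w, 1 <= K w)
  (hI : forall w, Num.max (opnorm (U w)) (opnorm (V w)) <= 4 ->
     forall z : R[i], 0 < complex.Im z -> Num.max `|complex.Re z| (complex.Im z) <= 8 ->
     4 * cstar ^+ 2 * K w ^+ 2 / N%:R <= edge_dist z ^+ 2 * complex.Im z ->
     \big[Num.max/0]_(i < N)
       cabs (invmx (U w *m V w + V w *m U w - z%:M) i i - m z)
     <= K w / Num.sqrt (N%:R * edge_dist z * complex.Im z))
  (hII : forall t : R, 0 < t ->
     (P [set w | (t `^ (2 * alpha0 + 1) < K w)%R] <=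
      (beta0 alpha0 alpha1 * N%:R `^ beta1 *
         expR (- beta2 alpha0 alpha1 * t))%:E)%E)
  (w : T) (hw : Num.max (opnorm (U w)) (opnorm (V w)) <= 4)
  (lambda : R[i]) (x : 'cV[R[i]]_N)
  (heig : (U w *m V w + V w *m U w) *m x = lambda *: x)
  (hunit : \sum_(i < N) cabs (x i 0) ^+ 2 = 1)
  (hlambda : cabs lambda <= 8)
  (rho : R) (hrho : rho = 4 * cstar ^+ 2 * K w ^+ 2 / N%:R) (hrho1 : rho < 1)
  (sigma : R) (hsigma : rho <= sigma <= rho `^ (1 / 3))
  (hsigma_eq : rho =
     edge_dist (lambda + sigma *i) ^+ 2 * complex.Im (lambda + sigma *i)) :
  \big[Num.max/0]_(i < N) cabs (x i 0) <= Num.sqrt (2 * sigma).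

Proof.
have N0 : 0 < N%:R :> R by rewrite ltr0n; case: (N) hN.
have c0 : 0 < cstar by apply: lt_le_trans hcstar1.
have K0 : 0 < K w by apply: lt_le_trans (hK1 w).
have rho0 : 0 < rho by rewrite hrho divr_gt0 ?mulr_gt0 ?exprn_gt0.
have [rho_sigma sigma_rho] := andP hsigma.
have sigma0 : 0 < sigma := lt_le_trans rho0 rho_sigma.
have sigma1 : sigma <= 1.
  apply: le_trans sigma_rho _.
  apply: le_trans (_ : 1 `^ (1 / 3) <= 1); last by rewrite powR1.
  by rewrite ge0_ler_powR ?nnegrE ?ltW ?divr_gt0.
set X := U w *m V w + V w *m U w in heig.
have hX : X \is hermsymmx by exact: hermsymmx_anticommutator.
set z := lambda + sigma *i in hsigma_eq.
apply: bigmax_le => [|i _]; first exact: sqrtr_ge0.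
rewrite -(ger0_norm (cabs_ge0 (x i 0))) -sqrtr_sqr ler_wsqrtr //.
have [lambda_real] := unit_eigenvector_entry_le i hX sigma0 heig hunit.
move=> /le_trans; apply; rewrite mulrC ler_pM2r //.
have Imz : complex.Im z = sigma by rewrite raddfD /= lambda_real add0r.
have Rez : complex.Re z = complex.Re lambda by rewrite raddfD /= addr0.
have Imz0 : 0 < complex.Im z by rewrite Imz.
have dom : Num.max `|complex.Re z| (complex.Im z) <= 8.
  rewrite ge_max Imz Rez (le_trans sigma1) ?ler1n // andbT.
  by apply: le_trans hlambda; rewrite -lecR -cabsE; exact: normc_ge_Re.
set h := edge_dist z in hsigma_eq; rewrite Imz in hsigma_eq.
have h0 : 0 < h.
  rewrite lt_neqAle edge_dist_ge0 andbT; apply/eqP => hz.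
  by move: rho0; rewrite hsigma_eq -hz expr0n mul0r ltxx.
(* The factors 4 cstar^2 >= 1 and h <= 1 are lost here; keeping them would give
   the error sqrt h / (2 cstar). *)
have K_le : K w ^+ 2 <= N%:R * h * sigma.
  have KE : 4 * cstar ^+ 2 * K w ^+ 2 = N%:R * (h ^+ 2 * sigma).
    by rewrite -hsigma_eq hrho [RHS]mulrC divfK ?gt_eqF.
  have c1 : 1 <= 4 * cstar ^+ 2 by nra.
  apply: le_trans (_ : 4 * cstar ^+ 2 * K w ^+ 2 <= _).
    by rewrite ler_peMl ?sqr_ge0.
  rewrite KE -mulrA ler_pM2l // ler_pM2r // expr2 ler_piMl ?(ltW h0) //.
  exact: edge_dist_le1.
have resolvent_close : cabs (invmx (X - z%:M) i i - m z) <= 1.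
  have rho_le : 4 * cstar ^+ 2 * K w ^+ 2 / N%:R <= h ^+ 2 * complex.Im z.
    by rewrite -hrho Imz hsigma_eq.
  apply: le_trans (le_bigmax 0 (fun j => cabs (invmx (X - z%:M) j j - m z)) i) _.
  apply: le_trans (hI w hw z Imz0 dom rho_le) _.
  rewrite Imz ler_pdivrMr ?mul1r ?sqrtr_gt0 ?mulr_gt0 //.
  by rewrite -(ger0_norm (ltW K0)) -sqrtr_sqr ler_wsqrtr.
rewrite -(subrK (m z) (invmx _ i i)) raddfD /= -[2]/(1 + 1) lerD //.
  exact: le_trans (Im_le_cabs _) resolvent_close.
exact/ltW/(cubic_root_Im_lt1 Imz0)/hcubic.
Qed.
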